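(* Let $\mathcal P$ be a collection of probability measures on a measurable space $(\Omega,\mathcal F)$, and let $(X_n)_{n=1}^\infty$ be random variables on $(\Omega,\mathcal F)$ that are independent and identically distributed under every $P\in\mathcal P$; write $X$ for a generic copy of $X_1$. Let $0<q<2$ and set $\mu(P;q)=\mathbb E_P(X)$ if $1\le q<2$ and $\mu(P;q)=0$ if $0<q<1$. Consider the condition $$\lim_{m\to\infty}\sup_{P\in\mathcal P}\mathbb E_P\left(|X-\mu(P;q)|^q\,\mathbf 1\{|X-\mu(P;q)|^q>m\}\right)=0.\qquad(\mathrm{UI}_q)$$ (i) If $(\mathrm{UI}_q)$ holds with $q\in[1,2)$, then for every $\varepsilon>0$, $$\lim_{m\to\infty}\sup_{P\in\mathcal P}P\left(\sup_{k\ge m}\left|\frac1{k^{1/q}}\sum_{i=1}^k(X_i-\mathbb E_P(X))\right|\ge\varepsilon\right)=0.$$ (ii) If $(\mathrm{UI}_q)$ holds with $q\in(0,1)$, then for every $\varepsilon>0$, $$\lim_{m\to\infty}\sup_{P\in\mathcal P}P\left(\sup_{k\ge m}\left|\frac1{k^{1/q}}\sum_{i=1}^kX_i\right|\ge\varepsilon\right)=0.$$ (iii) If $(\mathrm{UI}_q)$ does not hold, then it is not the case that for every $\varepsilon>0$, $$\lim_{m\to\infty}\sup_{P\in\mathcal P}P\left(\sup_{k\ge m}\left|\frac1{k^{1/q}}\sum_{i=1}^k(X_i-\mu(P;q))\right|\ge\varepsilon\right)=0.$$ In other words, $n^{-1/q}\sum_{i=1}^n(X_i-\mu(P;q))$ vanishes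 $\mathcal P$-uniformly almost surely if and only if $(\mathrm{UI}_q)$ holds.
   Context: $\mathbb E_P$ denotes expectation under $P$. A sequence $(Y_n)=(Y_n(P))$ of random variables (possibly depending on $P$) vanishes $\mathcal P$-uniformly almost surely if for every $\varepsilon>0$, $\lim_{m\to\infty}\sup_{P\in\mathcal P}P(\sup_{k\ge m}|Y_k(P)|\ge\varepsilon)=0$. When $1\le q<2$, it is understood that $\mathbb E_P|X|<\infty$ for every $P\in\mathcal P$, so that $\mathbb E_P(X)$ is well defined. *)

(* Defs.v *)
From HB Require Import structures.
From mathcomp Require Import all_boot all_order all_algebra.
From mathcomp Require Import all_classical all_reals all_analysis.

Set Implicit Arguments.
Unset Strict Implicit.
Unset Printing Implicit Defensive.

Import Order.TTheory GRing.Theory Num.Theory.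
Import numFieldNormedType.Exports.

Local Open Scope classical_set_scope.
Local Open Scope ring_scope.

(* Sequences are indexed from 0: [X 0] is the first variable of the sequence
   (X_1 on paper), and [\sum_(i < k) X i] is the sum of the first k variables. *)

(* Mutual independence: the product rule for every finite subfamily, the
   subfamily being listed without repetition by [s]. *)
Definition independent_RVs (R : realType) (d : measure_display)
    (T : measurableType d) (P : probability T R) (X : nat -> {mfun T >-> R})
    : Prop :=
  forall (s : seq nat) (B : nat -> set R), uniq s ->
    (forall i, measurable (B i)) ->
    P (\bigcap_(i in [set` s]) (X i @^-1` B i)) =
    (\prod_(i <- s) P (X i @^-1` B i))%E.

Definition identically_distributed (R : realType) (d : measure_display)
    (T : measurableType d) (P : probability T R) (X : nat -> {mfun T >-> R})
    : Prop :=
  forall (n : nat) (B : set R), measurable B ->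
    distribution P (X n) B = distribution P (X 0%N) B.

Definition iid (R : realType) (d : measure_display) (T : measurableType d)
    (P : probability T R) (X : nat -> {mfun T >-> R}) : Prop :=
  independent_RVs P X /\ identically_distributed P X.

Definition real_expectation (R : realType) (d : measure_display) (T : measurableType d)
    (P : probability T R) (X : T -> R) : R :=
  fine ('E_P[X])%E.

(* Meant for [0 < q < 2] and, if [1 <= q], for [X] integrable under [P]. *)
Definition centering (R : realType) (d : measure_display) (T : measurableType d)
    (P : probability T R) (q : R) (X : T -> R) : R :=
  if 1 <= q then real_expectation P X else 0.

(* The suprema over [PP] here and in [vanishes_uniformly_as] are taken in
   [\bar R], so on the empty collection they are -oo and both properties are
   false. The expectation is that of a nonnegative function; it may be +oo. *)
Definition unif_integrable (R : realType) (d : measure_display)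
    (T : measurableType d) (PP : set (probability T R)) (q : R) (X : T -> R)
    : Prop :=
  ereal_sup
    [set ('E_P[(fun w => `|X w - centering P q X| `^ q *
                         \1_[set v | m < `|X v - centering P q X| `^ q] w)%R])%E
    | P in PP] @[m --> +oo] --> 0%E.

(* [esups u m] is the supremum of [u k] over [k >= m], in [\bar R]. *)
Definition vanishes_uniformly_as (R : realType) (d : measure_display)
    (T : measurableType d) (PP : set (probability T R))
    (Y : probability T R -> nat -> T -> R) : Prop :=
  forall eps : R, 0 < eps ->
    ereal_sup
      [set P [set w | (eps%:E <= esups (fun k => `|Y P k w|%:E) m)%E]
      | P in PP] @[m --> \oo] --> 0%E.

(* Main.v *)
Require Import Defs.
From HB Require Import structures.
From mathcomp Require Import all_boot all_order all_algebra.
From mathcomp Require Import all_classical all_reals all_analysis.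
From mathcomp Require Import measurable_realfun.
From mathcomp Require Import ring lra.

(** Both directions compare the recentred variables [Y i = X i - c], where [c]
    is the centering constant, with the two pieces into which a level [t] cuts
    them: [trunc q t y] keeps [y] when [|y|^q <= t], and [excess q t y] is
    [|y|^q] when [|y|^q > t]. Uniform integrability says that the integral of
    [excess q K (Y 0)] is small uniformly in [P] once [K] is large.

    From uniform integrability to the strong law, fix the time horizon [m] and
    truncate [Y i] at the level [t_i = max (i + 1, m)]. Flooring the level at
    [m] makes everything quantitative with one parameter:
    - some [Y i] exceeds its level with probability at most the integral of
      [excess q m (Y 0)] ([probability_excess_le]), since the number of [i] with
      [t_i < x] is at most [x], and is zero if [x <= m];
    - off that event the partial sums are those of the truncated variables,
      whose means sum up to [k] at most a small multiple of [k^(1/q)]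
      ([drift_le_centered] when [1 <= q], where the mean of [Y 0] vanishes, and
      [drift_le_uncentered] when [q < 1], where absolute values suffice);
    - the centred truncated variables are bounded and independent, so the
      Hajek-Renyi maximal inequality ([hajek_renyi]) with weights
      [max (k, m)^(-2/q)] bounds the probability that one of their normalized
      sums beyond time [m] is large by a weighted sum of variances, which
      [variance_sum_le] controls by [K^r * m^(1 - r)], with [r = 2/q > 1], and
      the integral of [excess q K (Y 0)].
    All bounds involve [P] only through the integral of the excess, hence they
    are uniform ([finite_crossing_le], [vanishes_of_unif_integrable]).

    Conversely, for [i > 0], [|Y i|^q >= i + 1] forces one of the two normalized
    sums surrounding time [i] to be at least one half in absolute value. If the
    probability [a] that this happens beyond time [m] is at most one half, then
    by independence, as in the second Borel-Cantelli lemma, the events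
    [|Y 0|^q >= i + 1], [i >= m], have probabilities of sum at most [2 * a]
    ([borel_cantelli_sum_le]), and that sum dominates the integral of the excess
    of [Y 0] over any level above [2 * (m + 1)] ([integral_excess_le]). *)

Set Implicit Arguments.
Unset Strict Implicit.
Unset Printing Implicit Defensive.

Import Order.TTheory GRing.Theory Num.Theory.
Import numFieldNormedType.Exports.

Local Open Scope classical_set_scope.
Local Open Scope ring_scope.

(** * Powers and their sums *)

Lemma powR_invK (R : realType) (q x : R) : q != 0 -> 0 <= x ->
  (x `^ q) `^ q^-1 = x.
Proof. by move=> q0 x0; rewrite -powRrM mulfV// powRr1. Qed.

(** From [1 - x <= exp (- x)] with [x = 1 / (n + 1)]. It plays the role of the
    derivative of a power, and the two estimates below telescope it. *)
Lemma powR_succ_decr (R : realType) (p : R) (n : nat) : 0 <= p ->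
  n%:R `^ p <= n.+1%:R `^ p * expR (- (p / n.+1%:R)).
Proof.
move=> p0; have -> : - (p / n.+1%:R) = - n.+1%:R^-1 * p :> R by rewrite mulNr mulrC.
rewrite expRM -powRM ?expR_ge0//.
apply: ge0_ler_powR; rewrite ?nnegrE ?mulr_ge0 ?expR_ge0//.
have n1 : (0 : R) < n.+1%:R by rewrite ltr0n.
have -> : n%:R = n.+1%:R * (1 + - n.+1%:R^-1) :> R.
  by rewrite mulrDr mulr1 mulrN mulfV ?gt_eqF// -natr1 addrK.
by rewrite ler_pM2l// expR_ge1Dx.
Qed.

(** Comparison of the sum with the integral of [x^(a - 1)], by telescoping
    [k^a]; the factor 2 is the price of bounding [1 / (1 + y)] by [1 - y / 2]
    for [y] in the unit interval. *)
Lemma sum_powR_le (R : realType) (a : R) (k : nat) : 0 < a -> a <= 1 ->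
  \sum_(i < k) i.+1%:R `^ (a - 1) <= 2 / a * k%:R `^ a.
Proof.
move=> a0 a1; elim: k => [|k IH].
  by rewrite big_ord0 powR0 ?gt_eqF// mulr0.
rewrite big_ord_recr /=; apply: (le_trans (lerD IH (lexx _))).
have k1 : (0 : R) < k.+1%:R by rewrite ltr0n.
have k0 : k.+1%:R != 0 :> R by rewrite gt_eqF.
set y := a / k.+1%:R.
have y0 : 0 < y by rewrite divr_gt0.
have y1 : y <= 1.
  by rewrite ler_pdivrMr// mul1r (le_trans a1)// ler1n.
have h : k%:R `^ a <= k.+1%:R `^ a * (1 - y / 2).
  apply: (le_trans (powR_succ_decr k (ltW a0))).
  rewrite ler_wpM2l ?powR_ge0// expRN -/y.
  have e := expR_ge1Dx y.
  apply: (@le_trans _ _ (1 + y)^-1).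
    by rewrite lef_pV2 ?posrE ?expR_gt0//; lra.
  by rewrite -[_^-1]mul1r ler_pdivrMr; nra.
have -> : k.+1%:R `^ (a - 1) = k.+1%:R `^ a / k.+1%:R :> R.
  by rewrite powRB ?k0 ?implybT// powRr1 // ltW.
rewrite -lerBrDr.
have -> : 2 / a * k.+1%:R `^ a - k.+1%:R `^ a / k.+1%:R =
   2 / a * (k.+1%:R `^ a * (1 - y / 2)) :> R.
  by rewrite /y; move: k0 (_ `^ a); move: (k.+1%:R) => K K0 w; field; rewrite K0 gt_eqF.
by rewrite ler_wpM2l// divr_ge0// ltW.
Qed.

(** The first [N] terms contribute at most [N * N^(-r) = N^(1 - r)], and the
    tail is compared with the integral of [x^(-r)] beyond [N], that is
    [N^(1 - r) / (r - 1)]. *)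
Lemma sum_powR_maxn_le (R : realType) (r : R) (N n : nat) :
  1 < r -> (0 < N)%N ->
  \sum_(i < n) (maxn i.+1 N)%:R `^ (- r) <= r / (r - 1) * N%:R `^ (1 - r).
Proof.
move=> r1 N0; set s := r - 1; have s0 : 0 < s by rewrite /s subr_gt0.
have -> : 1 - r = - s by rewrite /s opprB.
have step (k : nat) : (0 < k)%N ->
    k.+1%:R `^ (- r) <= s^-1 * (k%:R `^ (- s) - k.+1%:R `^ (- s)) :> R.
  move=> k0.
  have k1 : (0 : R) < k.+1%:R by rewrite ltr0n.
  have kp : (0 : R) < k%:R by rewrite ltr0n.
  have kn0 : k.+1%:R != 0 :> R by rewrite gt_eqF.
  have e : k.+1%:R `^ (- s) * (1 + s / k.+1%:R) <= k%:R `^ (- s) :> R.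
    apply: (@le_trans _ _ (k.+1%:R `^ (- s) * expR (s / k.+1%:R))).
      by rewrite ler_wpM2l ?powR_ge0// expR_ge1Dx.
    rewrite !powRN -[X in _ * X]invrK -expRN -invfM.
    rewrite lef_pV2 ?posrE ?mulr_gt0 ?powR_gt0 ?expR_gt0//.
    exact: powR_succ_decr (ltW s0).
  have -> : - r = - s - 1 by rewrite /s; ring.
  rewrite powRB ?kn0 ?implybT// powRr1 ?(ltW k1)//.
  rewrite ler_pdivlMl// lerBrDl.
  by apply: le_trans e; rewrite mulrDr mulr1 mulrCA.
have rs : r / s = 1 + s^-1 by rewrite /s; field; rewrite subr_eq0 gt_eqF.
have NN : N%:R * N%:R `^ (- r) = N%:R `^ (- s) :> R.
  rewrite -{1}[N%:R]powRr1// -powRD; first by congr (_ `^ _); rewrite /s; ring.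
  by rewrite pnatr_eq0 -lt0n N0 implybT.
have sN : 0 <= s^-1 by rewrite invr_ge0 ltW.
have small (k : nat) : (k <= N)%N ->
    \sum_(i < k) (maxn i.+1 N)%:R `^ (- r) <= N%:R `^ (- s) :> R.
  move=> kN; rewrite -NN.
  rewrite (eq_bigr (fun=> N%:R `^ (- r))); last first.
    move=> i _; congr (_%:R `^ _); apply/maxn_idPr.
    exact: leq_trans (ltn_ord i) kN.
  rewrite sumr_const card_ord -[_ *+ k]mulr_natl ler_wpM2r ?powR_ge0//.
  by rewrite ler_nat.
have big (j : nat) : \sum_(i < N + j) (maxn i.+1 N)%:R `^ (- r) <=
    N%:R `^ (- s) + s^-1 * (N%:R `^ (- s) - (N + j)%:R `^ (- s)) :> R.
  elim: j => [|j IH]; first by rewrite addn0 subrr mulr0 addr0 small.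
  rewrite addnS big_ord_recr /=.
  have -> : maxn (N + j).+1 N = (N + j).+1.
    by apply/maxn_idPl; rewrite leqW// leq_addr.
  apply: (le_trans (lerD IH (step _ _))); first by rewrite addn_gt0 N0.
  by rewrite -addrA -mulrDr addrA subrK.
have [nN|Nn] := leqP n N.
  apply: (le_trans (small _ nN)).
  by rewrite rs mulrDl mul1r lerDl mulr_ge0 ?powR_ge0.
rewrite -(subnKC (ltnW Nn)); apply: (le_trans (big _)).
by rewrite rs mulrDl mul1r lerD2l ler_wpM2l// gerBl powR_ge0.
Qed.

Lemma near_infty_powR_small (R : realType) (A s eta : R) :
  0 < s -> 0 < eta -> \forall m \near \oo, A * m%:R `^ (- s) <= eta.
Proof.
move=> s0 eta0; near=> m.
have m0 : (0 : R) < m%:R.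
  by rewrite ltr0n; near: m; exact: nbhs_infty_gt.
rewrite powRN ler_pdivrMr ?powR_gt0// mulrC -ler_pdivrMr//.
apply: (@le_trans _ _ (`|A| / eta)).
  by rewrite ler_pM2r ?invr_gt0// ler_norm.
have Ae : 0 <= `|A| / eta by rewrite divr_ge0// ltW.
have sV : s^-1 != 0 by rewrite gt_eqF// invr_gt0.
rewrite -(powR_invK sV Ae) invrK.
apply: ge0_ler_powR; rewrite ?nnegrE ?powR_ge0 ?(ltW s0)//.
by near: m; exact: nbhs_infty_ger.
Unshelve. all: by end_near. Qed.

(** * Truncation and excess of a real number *)

Definition trunc (R : realType) (q t y : R) : R :=
  if `|y| `^ q <= t then y else 0.

Definition excess (R : realType) (q t y : R) : R :=
  if t < `|y| `^ q then `|y| `^ q else 0.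

Lemma excess_ge0 (R : realType) (q t y : R) : 0 <= excess q t y.
Proof. by rewrite /excess; case: ifP => // _; exact: powR_ge0. Qed.

Lemma excess_le (R : realType) (q s t y : R) : s <= t ->
  excess q t y <= excess q s y.
Proof.
move=> st; rewrite /excess; case: ifPn => [ty|_]; first by rewrite (le_lt_trans st).
by case: ifP => // _; exact: powR_ge0.
Qed.

Lemma normr_trunc (R : realType) (q t y : R) : 0 < q ->
  `|trunc q t y| <= t `^ q^-1.
Proof.
move=> q0; rewrite /trunc; case: ifPn => [yt|_]; last by rewrite normr0 powR_ge0.
rewrite -{1}(@powR_invK _ q `|y|) ?gt_eqF// ge0_ler_powR ?nnegrE ?powR_ge0//.
  by rewrite invr_ge0 ltW.
exact: le_trans (powR_ge0 _ _) yt.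
Qed.

(** With [x = |y|^q], the number of positive integers below [x] is at most [x],
    and no level [max (i + 1, m)] is below [x] unless [m < x]. *)
Lemma count_excess_le (R : realType) (q y : R) (m n : nat) :
  \sum_(i < n) ((maxn i.+1 m)%:R < `|y| `^ q)%R%:R <= excess q m%:R y.
Proof.
rewrite /excess; set x := `|y| `^ q; have x0 : 0 <= x by exact: powR_ge0.
case: ltP => mx; last first.
  rewrite big1// => i _; case: ltP => // h.
  by have := lt_le_trans h mx; rewrite ltr_nat ltnNge leq_maxr.
suff H k : \sum_(i < k) ((maxn i.+1 m)%:R < x)%R%:R <= Num.min k%:R x.
  by apply: (le_trans (H n)); rewrite ge_min lexx orbT.
elim: k => [|k IH]; first by rewrite big_ord0 le_min lexx.
rewrite big_ord_recr /=; case: ltP => h; last first.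
  by rewrite addr0 (le_trans IH)// le_min !ge_min lexx orbT ler_nat leqnSn.
have kx : k.+1%:R < x by apply: le_lt_trans h; rewrite ler_nat leq_maxl.
rewrite min_l; last exact: ltW.
by rewrite -[k.+1%:R]natr1 lerD2r (le_trans IH)// ge_min lexx.
Qed.

(** With [x = |y|^q], so that [y^2 = x^r], the left-hand side is [x^r] times
    the sum of [t^(-r)] over the levels [t = max (k + 1, m)] not below [x], hence
    of order [x^r * max (x, m)^(1 - r)]. This is at most [K^r * m^(1 - r)] if
    [x <= K], and at most [x] otherwise. *)
Lemma variance_sum_le (R : realType) (q K y : R) (m n : nat) (r := 2 / q) :
  0 < q -> q < 2 -> 0 <= K -> (0 < m)%N ->
  \sum_(k < n) (maxn k.+1 m)%:R `^ (- r) * trunc q (maxn k.+1 m)%:R y ^+ 2 <=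
  r / (r - 1) * (K `^ r * m%:R `^ (1 - r)) + r / (r - 1) * excess q K y.
Proof.
move=> q0 q2 K0 m0.
have r1 : 1 < r by rewrite /r ltr_pdivlMr// mul1r.
set x := `|y| `^ q; have x0 : 0 <= x by exact: powR_ge0.
set C := r / (r - 1).
have C0 : 0 <= C by rewrite /C divr_ge0// ?subr_ge0 ltW// (lt_trans ltr01).
have y2 : y ^+ 2 = x `^ r.
  rewrite /x -powRrM /r mulrC divfK ?gt_eqF//.
  by rewrite powR_mulrn// real_normK// num_real.
have exN : exists k : nat, x <= k%:R.
  by exists (Num.truncn x).+1; rewrite ltW// truncnS_gt.
(* [N1] is the ceiling of [x]: an integer level is at least [x] when it is at least [N1] *)
case: (ex_minnP exN) => N1 xN1 leastN1.
pose N := maxn N1 m.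
have N0 : (0 < N)%N by rewrite /N leq_max m0 orbT.
have Np : (0 : R) < N%:R by rewrite ltr0n.
have xN : x <= N%:R by rewrite (le_trans xN1)// ler_nat leq_maxl.
apply: (@le_trans _ _ (x `^ r * \sum_(k < n) (maxn k.+1 N)%:R `^ (- r))).
  rewrite mulr_sumr; apply: ler_sum => k _; rewrite /trunc -/x.
  case: ifPn => [xk|_]; last by rewrite expr0n mulr0 mulr_ge0 ?powR_ge0.
  have -> : maxn k.+1 m = maxn k.+1 N.
    by rewrite /N maxnCA; apply/esym/maxn_idPr; exact: leastN1.
  by rewrite mulrC y2.
apply: (@le_trans _ _ (C * (x `^ r * N%:R `^ (1 - r)))).
  by rewrite mulrCA ler_wpM2l ?powR_ge0// sum_powR_maxn_le.
rewrite -mulrDr ler_wpM2l// /excess -/x.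
have rN : r - 1 >= 0 by rewrite subr_ge0 ltW.
have neg : 1 - r = - (r - 1) by rewrite opprB.
have anti (u v : R) : 0 < u -> u <= v -> v `^ (1 - r) <= u `^ (1 - r).
  move=> u0 uv; have v0 := lt_le_trans u0 uv.
  rewrite neg !powRN lef_pV2 ?posrE ?powR_gt0//.
  by apply: ge0_ler_powR; rewrite ?nnegrE ?(ltW u0) ?(ltW v0).
case: ltP => Kx.
  have xp := le_lt_trans K0 Kx.
  rewrite ler_wpDl ?mulr_ge0 ?powR_ge0//.
  apply: (@le_trans _ _ (x `^ r * x `^ (1 - r))).
    by rewrite ler_wpM2l ?powR_ge0// anti.
  rewrite -powRD; last by rewrite (gt_eqF xp) implybT.
  by rewrite [r + _]addrC subrK powRr1// ltW.
rewrite addr0 ler_pM ?powR_ge0//.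
  by rewrite ge0_ler_powR ?nnegrE// (le_trans ler01)// ltW.
by apply: anti; rewrite ?ltr0n// ler_nat leq_maxr.
Qed.

(** With [x = |y|^q > t], one has [|y| = x^(1/q - 1) * x] and the exponent
    [1/q - 1] is nonpositive. *)
Lemma normr_sub_trunc_le_excess (R : realType) (q t y : R) : 1 <= q -> 0 < t ->
  `|y - trunc q t y| <= t `^ (q^-1 - 1) * excess q t y.
Proof.
move=> q1 t0; have q0 : 0 < q := lt_le_trans ltr01 q1.
rewrite /trunc /excess; case: leP => h.
  by rewrite subrr normr0 mulr0.
have x0 := lt_trans t0 h.
rewrite subr0 -{1}(@powR_invK _ q `|y|) ?gt_eqF//.
rewrite -{1}(subrK 1 q^-1) powRD; last by rewrite (gt_eqF x0) implybT.
rewrite powRr1 ?(ltW x0)// ler_wpM2r ?(ltW x0)//.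
rewrite -(opprB 1) !powRN.
have p0 := powR_gt0 (1 - q^-1) t0; have p1 := powR_gt0 (1 - q^-1) x0.
rewrite lef_pV2 ?posrE//.
by apply: ge0_ler_powR; rewrite ?nnegrE ?(ltW t0) ?(ltW x0) ?(ltW h)// subr_ge0 invf_le1.
Qed.

(** With [x = |y|^q <= t], either [x <= K] or [|y| = x^(1/q - 1) * x], where
    now the exponent [1/q - 1] is nonnegative. *)
Lemma normr_trunc_le_excess (R : realType) (q t K y : R) : 0 < q -> q <= 1 -> 0 <= K ->
  `|trunc q t y| <= K `^ q^-1 + t `^ (q^-1 - 1) * excess q K y.
Proof.
move=> q0 q1 K0; have a1 : 0 <= q^-1 - 1 by rewrite subr_ge0 invf_ge1.
have rhs0 : 0 <= K `^ q^-1 + t `^ (q^-1 - 1) * excess q K y.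
  by rewrite addr_ge0 ?mulr_ge0 ?powR_ge0 ?excess_ge0.
rewrite /trunc; case: ifPn => yt; last by rewrite normr0.
move: rhs0; rewrite /excess; case: ltP => h _.
  have x0 := le_lt_trans K0 h.
  rewrite ler_wpDl ?powR_ge0//.
  rewrite -{1}(@powR_invK _ q `|y|) ?gt_eqF//.
  rewrite -{1}(subrK 1 q^-1) powRD; last by rewrite (gt_eqF x0) implybT.
  rewrite powRr1 ?(ltW x0)// ler_wpM2r ?(ltW x0)//.
  by apply: ge0_ler_powR; rewrite ?nnegrE ?(ltW x0)// (le_trans (ltW x0)).
rewrite mulr0 addr0 -{1}(@powR_invK _ q `|y|) ?gt_eqF//.
by rewrite ge0_ler_powR ?nnegrE ?powR_ge0// invr_ge0 ltW.
Qed.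

Lemma measurable_normr_powR (R : realType) (q : R) :
  measurable_fun setT (fun y : R => `|y| `^ q).
Proof.
have mq := @measurable_powR R q.
exact: (measurableT_comp mq (@normr_measurable R setT)).
Qed.

Lemma measurable_trunc (R : realType) (q t : R) :
  measurable_fun setT (trunc q t).
Proof.
apply: measurable_fun_ifT; [|exact: measurable_id|exact: measurable_cst].
by apply: measurable_fun_ler; [exact: measurable_normr_powR|exact: measurable_cst].
Qed.

Lemma measurable_excess (R : realType) (q t : R) :
  measurable_fun setT (excess q t).
Proof.
apply: measurable_fun_ifT; [|exact: measurable_normr_powR|exact: measurable_cst].
by apply: measurable_fun_ltr; [exact: measurable_cst|exact: measurable_normr_powR].
Qed.

Lemma measurable_gt_powR (R : realType) (q b : R) :
  measurable [set y : R | b < `|y| `^ q].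
Proof.
have := measurable_fun_ltr (@measurable_cst _ _ _ _ setT b)
  (@measurable_normr_powR R q).
by move=> /(_ measurableT [set true] I); rewrite setTI.
Qed.

Lemma measurable_ge_powR (R : realType) (q b : R) :
  measurable [set y : R | b <= `|y| `^ q].
Proof.
have := measurable_fun_ler (@measurable_cst _ _ _ _ setT b)
  (@measurable_normr_powR R q).
by move=> /(_ measurableT [set true] I); rewrite setTI.
Qed.

(** * Integrals of real random variables *)

Definition mfun_of (d d' : measure_display) (T : measurableType d)
    (T' : measurableType d') (f : T -> T') (mf : measurable_fun setT f) :
  {mfun T >-> T'} := mfun_Sub (mem_set mf).

Lemma bounded_integrable (R : realType) (d : measure_display)
    (T : measurableType d) (P : probability T R) (f : T -> R) (M : R) :
  measurable_fun setT f -> (forall w, `|f w| <= M) ->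
  P.-integrable setT (EFin \o f).
Proof.
move=> mf fM; apply: measurable_bounded_integrable => //.
  by rewrite ltey_eq fin_num_measure.
exists M; split; first exact: num_real.
by move=> N MN w _ /=; rewrite (le_trans (fM w))// ltW.
Qed.

Lemma Rintegral_probability_cst (R : realType) (d : measure_display)
    (T : measurableType d) (P : probability T R) (b : R) :
  \int[P]_(_ in [set: T]) b = b.
Proof.
have PT : fine (P setT) = 1 := congr1 fine (@probability_setT _ _ _ P).
by rewrite Rintegral_cst// PT mulr1.
Qed.

Lemma Rintegral_sum (R : realType) (d : measure_display)
    (T : measurableType d) (P : probability T R) (f : nat -> T -> R) (n : nat) :
  (forall i, (i < n)%N -> P.-integrable setT (EFin \o f i)) ->
  P.-integrable setT (EFin \o (fun w => \sum_(i < n) f i w)) /\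
  \int[P]_w (\sum_(i < n) f i w) = \sum_(i < n) \int[P]_w f i w.
Proof.
elim: n => [|n IH] intf.
  split; last first.
    under eq_Rintegral do rewrite big_ord0.
    by rewrite big_ord0 Rintegral_cst// mul0r.
  by apply: eq_integrable (integrable0 _ _) => // w _; rewrite /= big_ord0.
have [i1 i2] := IH (fun i h => intf i (ltnW h)).
have fn := intf n (ltnSn n).
split.
  apply: eq_integrable (integrableD _ i1 fn) => // w _.
  by rewrite /= big_ord_recr.
under eq_Rintegral do rewrite big_ord_recr.
by rewrite RintegralD// i2 big_ord_recr.
Qed.

Lemma ident_Rintegral (R : realType) (d : measure_display)
    (T : measurableType d) (P : probability T R) (Y : nat -> {mfun T >-> R})
    (g : R -> R) (M : R) (i : nat) :
  identically_distributed P Y -> measurable_fun setT g ->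
  (forall y, `|g y| <= M) ->
  \int[P]_w g (Y i w) = \int[P]_w g (Y 0%N w).
Proof.
move=> idY mg gM; rewrite /Rintegral.
have ig j : P.-integrable setT ((EFin \o g) \o Y j).
  apply: (@bounded_integrable _ _ _ P (g \o Y j) M).
    exact: measurableT_comp.
  by move=> w; exact: gM.
have mg' : measurable_fun setT (EFin \o g) by exact/measurable_EFinP.
congr fine; transitivity (\int[distribution P (Y i)]_y (EFin \o g) y)%E.
  by rewrite integral_distribution.
transitivity (\int[distribution P (Y 0%N)]_y (EFin \o g) y)%E.
  by apply: eq_measure_integral => A mA _; exact: idY.
by rewrite integral_distribution.
Qed.

(** How all pointwise bounds by the excess are integrated: only the bound
    [delta] on its integral enters, which is what makes them uniform in [P]. *)
Lemma Rintegral_le_excess (R : realType) (d : measure_display)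
    (T : measurableType d) (P : probability T R) (Y : {mfun T >-> R})
    (f : T -> R) (q K delta A B : R) :
  0 <= B -> P.-integrable setT (EFin \o f) ->
  (forall w, f w <= A + B * excess q K (Y w)) ->
  (\int[P]_w (excess q K (Y w))%:E <= delta%:E)%E ->
  \int[P]_w f w <= A + B * delta.
Proof.
move=> B0 intf fle Ele.
have me : measurable_fun setT (fun w => excess q K (Y w)).
  by apply: measurableT_comp => //; exact: measurable_excess.
have ie : P.-integrable setT (EFin \o (fun w => excess q K (Y w))).
  apply/integrableP; split; first exact/measurable_EFinP.
  under eq_integral do rewrite /= ger0_norm ?excess_ge0//.
  exact: le_lt_trans Ele (ltry _).
have iB : P.-integrable setT (EFin \o (fun w => B * excess q K (Y w))).
  exact: (integrableZl measurableT B ie).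
have iA : P.-integrable setT (EFin \o (fun _ : T => A)).
  exact: finite_measure_integrable_cst.
have iAB : P.-integrable setT (EFin \o (fun w => A + B * excess q K (Y w))).
  exact: (integrableD measurableT iA iB).
apply: (@le_trans _ _ (\int[P]_w (A + B * excess q K (Y w)))).
  by apply: le_Rintegral => // w _; exact: fle.
rewrite RintegralD// Rintegral_probability_cst lerD2l.
rewrite RintegralZl// ler_wpM2l// -lee_fin /Rintegral fineK//.
exact: integrable_fin_num ie.
Qed.

(** * Independence *)

Lemma independent_RVs_comp (R : realType) (d : measure_display)
    (T : measurableType d) (P : probability T R) (Y Z : nat -> {mfun T >-> R})
    (g : nat -> R -> R) :
  independent_RVs P Y -> (forall i, measurable_fun setT (g i)) ->
  (forall i w, Z i w = g i (Y i w)) -> independent_RVs P Z.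
Proof.
move=> indY mg ZE s B us mB.
have E i : Z i @^-1` B i = Y i @^-1` (g i @^-1` B i).
  by apply/seteqP; split => w /=; rewrite ZE.
under eq_bigcapr do rewrite E.
under eq_bigr do rewrite E.
by apply: indY => // i; rewrite -[X in measurable X]setTI; exact: mg.
Qed.

(** A pi-system generating the sigma-algebra of the first [k] variables. *)
Definition prefix_cylinders (R : realType) (d : measure_display)
    (T : measurableType d) (X : nat -> {mfun T >-> R}) (k : nat) : set (set T) :=
  [set G | exists2 B : nat -> set R, forall i, measurable (B i) &
     G = \bigcap_(i in [set` iota 0 k]) (X i @^-1` B i)].

Lemma prefix_cylinders_measurable (R : realType) (d : measure_display)
    (T : measurableType d) (X : nat -> {mfun T >-> R}) (k : nat) :
  prefix_cylinders X k `<=` measurable.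
Proof.
move=> _ [B mB ->]; apply: fin_bigcap_measurable => [|i _].
  exact: finite_seq.
exact: measurable_funPTI.
Qed.

Lemma measurable_prefix (R : realType) (d : measure_display)
    (T : measurableType d) (X : nat -> {mfun T >-> R}) (k i : nat) :
  (i < k)%N -> measurable_fun setT
    (X i : g_sigma_algebraType (prefix_cylinders X k) -> R).
Proof.
move=> ik _ B mB; rewrite setTI; apply: sub_sigma_algebra.
exists (fun j => if j == i then B else setT).
  by move=> j; case: ifP.
apply/seteqP; split => w /= => [Xw j _|]; first by case: eqP => // ->.
by move=> /(_ i); rewrite eqxx /= mem_iota; apply.
Qed.

(** For fixed [B], both sides are finite measures in [G], and they agree on the
    cylinders by the product rule; so they agree on the generated sigma-algebra. *)
Lemma independent_past (R : realType) (d : measure_display)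
    (T : measurableType d) (P : probability T R) (X : nat -> {mfun T >-> R})
    (k j : nat) (G : set T) (B : set R) :
  independent_RVs P X -> (k <= j)%N -> <<s prefix_cylinders X k >> G ->
  measurable B -> P (G `&` X j @^-1` B) = (P G * P (X j @^-1` B))%E.
Proof.
move=> indX kj sG mB.
have mH : measurable (X j @^-1` B) by exact: measurable_funPTI.
have fH : P (X j @^-1` B) \is a fin_num by exact: fin_num_measure.
have r0 : (0 <= fine (P (X j @^-1` B))) by exact: fine_ge0.
rewrite muleC -[P (X j @^-1` B)]fineK//.
suff : mrestr P mH G = mscale (NngNum r0) P G by [].
apply: (g_sigma_algebra_measure_unique (prefix_cylinders X k) _ (fun=> setT)) => //.
- exact: prefix_cylinders_measurable.
- move=> _; exists (fun=> setT) => //.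
  by apply/seteqP; split.
- by rewrite bigcup_const//; exists 0%N.
- move=> _ _ [A mA ->] [C mC ->]; exists (fun i => A i `&` C i).
    by move=> i; exact: measurableI.
  by rewrite -bigcapI; apply: eq_bigcapr => i _; rewrite preimage_setI.
- move=> _ [A mA ->].
  change (P (\bigcap_(i in [set` iota 0 k]) (X i @^-1` A i) `&` X j @^-1` B) =
    ((fine (P (X j @^-1` B)))%:E *
      P (\bigcap_(i in [set` iota 0 k]) (X i @^-1` A i)))%E).
  rewrite fineK//.
  (* [j] is not among the first [k] indices, so the product rule applies to the
     first [k] constraints together with [B] at [j] *)
  pose C i := if i == j then B else A i.
  have mC i : measurable (C i) by rewrite /C; case: ifP.
  have CA i : i \in iota 0 k -> C i = A i.
    by rewrite mem_iota add0n /C => /andP[_ ik]; rewrite ltn_eqF// (leq_trans ik).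
  have Cj : C j = B by rewrite /C eqxx.
  have jk : j \notin iota 0 k by rewrite mem_iota add0n -leqNgt.
  have := indX (j :: iota 0 k) C _ mC.
  rewrite /= jk iota_uniq big_cons Cj => /(_ isT) E.
  rewrite (indX (iota 0 k) A (iota_uniq _ _) mA).
  transitivity (P (\bigcap_(i in [set` j :: iota 0 k]) X i @^-1` C i)); last first.
    by rewrite E; congr (_ * _)%E; apply: eq_big_seq => i ik; rewrite CA.
  congr (P _); apply/seteqP; split => w /=.
    move=> [H1 H2] i; rewrite /= inE => /orP[/eqP->|ik].
      by rewrite Cj.
    by rewrite CA//; exact: H1.
  move=> H; split; last by have := H j; rewrite /= inE eqxx Cj => /(_ isT).
  by move=> i /= ik; have := H i; rewrite /= inE ik orbT CA//; exact.
- move=> _; change (P (setT `&` X j @^-1` B) < +oo)%E.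
  by rewrite setTI ltey_eq fin_num_measure.
Qed.

(** The joint law of [U] and [V] is the product of their laws, because the two
    agree on rectangles; conclude by the theorem of Fubini. *)
Lemma Rintegral_prod_independent (R : realType) (d : measure_display)
    (T : measurableType d) (P : probability T R) (U V : T -> R) (M N : R) :
  measurable_fun setT U -> measurable_fun setT V ->
  (forall w, `|U w| <= M) -> (forall w, `|V w| <= N) ->
  (forall A B, measurable A -> measurable B ->
     P (U @^-1` A `&` V @^-1` B) = (P (U @^-1` A) * P (V @^-1` B))%E) ->
  (\int[P]_w (U w * V w) = \int[P]_w U w * \int[P]_w V w)%R.
Proof.
move=> mU mV UM VN indUV.
have iU := bounded_integrable P mU UM; have iV := bounded_integrable P mV VN.
have iUV : P.-integrable setT (EFin \o (fun w => U w * V w)).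
  apply: (@bounded_integrable _ _ _ P _ (M * N)).
    exact: measurable_funM.
  by move=> w; rewrite normrM ler_pM.
pose mu := distribution P (mfun_of mU); pose nu := distribution P (mfun_of mV).
pose UV := mfun_of (measurable_fun_pair mU mV).
pose f (z : R * R) := (z.1 * z.2)%:E.
have mf : measurable_fun setT f.
  apply/measurable_EFinP; apply: measurable_funM => //.
have E A : measurable A -> (mu \x nu)%E A = distribution P UV A.
  by apply: product_measure_unique => B C mB mC; exact: indUV.
have if' : (distribution P UV).-integrable setT f.
  exact: integrable_pushforward.
have ifp : (mu \x nu)%E.-integrable setT f.
  move/integrableP : if' => [_ fin]; apply/integrableP; split => //.
  rewrite (eq_measure_integral (distribution P UV))// => A mA _; exact: E.
have Eint : (\int[P]_w (U w * V w)%:E = \int[mu]_x \int[nu]_y f (x, y))%E.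
  rewrite (integral12_prod_meas1 ifp).
  rewrite (eq_measure_integral (distribution P UV)); last first.
    by move=> A mA _; exact: E.
  by rewrite integral_distribution.
have inu : nu.-integrable setT (EFin \o idfun).
  apply: integrable_pushforward => //.
  by apply/measurable_EFinP; exact: measurable_id.
have nuE : (\int[nu]_y y%:E = \int[P]_w (V w)%:E)%E.
  by rewrite (@integral_distribution _ _ _ _ _ P (mfun_of mV) EFin).
have muE : (\int[mu]_y y%:E = \int[P]_w (U w)%:E)%E.
  by rewrite (@integral_distribution _ _ _ _ _ P (mfun_of mU) EFin).
have inner x : (\int[nu]_y f (x, y) = x%:E * \int[P]_w (V w)%:E)%E.
  by rewrite -nuE -integralZl.
rewrite /Rintegral Eint (eq_integral _ _ (fun x _ => inner x)).
rewrite -[X in (\int[mu]_x (_ * X))%E]fineK; last exact: integrable_fin_num iV.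
rewrite integralZr//; last first.
  exact: (@integrable_pushforward _ _ _ _ _ U).
rewrite muE fineM//; exact: integrable_fin_num.
Qed.

(** * The Hajek-Renyi maximal inequality *)

Fixpoint uncrossed (R : realType) (a : R) (u : nat -> R) (n : nat) : bool :=
  if n is k.+1 then uncrossed a u k && (u k.+1 < a) else u 0%N < a.

Lemma uncrossedPn (R : realType) (a : R) (u : nat -> R) (n : nat) :
  reflect (exists2 k, (k <= n)%N & a <= u k) (~~ uncrossed a u n).
Proof.
elim: n => [|n IH] /=.
  rewrite -leNgt; apply: (iffP idP) => [|[k]]; first by exists 0%N.
  by rewrite leqn0 => /eqP->.
rewrite negb_and -leNgt; apply: (iffP orP) => [[/IH[k kn ak]|an]|[k kn ak]].
- by exists k => //; rewrite leqW.
- by exists n.+1.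
- move: kn; rewrite leq_eqVlt => /orP[/eqP kn|kn]; first by right; rewrite -kn.
  by left; apply/IH; exists k.
Qed.

Lemma measurable_uncrossed (R : realType) (d : measure_display)
    (T : measurableType d) (a : R) (u : nat -> T -> R) (n : nat) :
  (forall k, (k <= n)%N -> measurable_fun setT (u k)) ->
  measurable_fun setT (fun w => uncrossed a (u ^~ w) n).
Proof.
elim: n => [|n IH] mu /=; first by apply: measurable_fun_ltr => //; exact: mu.
apply: measurable_and; first by apply: IH => k kn; apply: mu; exact: leqW.
by apply: measurable_fun_ltr => //; exact: mu.
Qed.

(** The pathwise form of the Hajek-Renyi inequality. As long as no weighted
    square has crossed the level [a], the increment of [c k * S k ^+ 2] is at
    most [c k.+1 * (2 * S k * z k + z k ^+ 2)] because [c] decreases; after a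
    crossing the left-hand side is frozen at [a]. The cross terms have mean zero
    when the [z k] are independent and centred. *)
Lemma weighted_square_crossing (R : realType) (a : R) (c z : nat -> R)
    (n : nat) (S := fun k => \sum_(i < k) z i)
    (alive := uncrossed a (fun k => c k * S k ^+ 2)) :
  0 < a -> (forall k, 0 <= c k) -> (forall k, c k.+1 <= c k) ->
  (if alive n then c n * S n ^+ 2 else a) <=
  \sum_(k < n) c k.+1 * (2 * ((if alive k then S k else 0) * z k) + z k ^+ 2).
Proof.
move=> a0 c0 cn; elim: n => [|n IH].
  by rewrite /alive /= /S !big_ord0 expr0n mulr0 a0.
rewrite (big_ord_recr n) /=.
have SS : S n.+1 = S n + z n by rewrite /S big_ord_recr.
have sq : c n.+1 * S n.+1 ^+ 2 <=
    c n * S n ^+ 2 + c n.+1 * (2 * (S n * z n) + z n ^+ 2).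
  have h := ler_wpM2r (sqr_ge0 (S n)) (cn n).
  rewrite SS; apply: le_trans (lerD h (lexx _)).
  by rewrite -mulrDr ler_wpM2l// sqrrD -mulr_natl addrA.
have -> : alive n.+1 = alive n && (c n.+1 * S n.+1 ^+ 2 < a) by [].
case: (alive n) IH => IH /=; last first.
  rewrite mul0r mulr0 add0r; apply: (le_trans IH).
  by rewrite lerDl mulr_ge0// sqr_ge0.
have {}sq := le_trans sq (lerD IH (lexx _)).
by case: (ltP (c n.+1 * S n.+1 ^+ 2) a) => // h; exact: le_trans h sq.
Qed.

(** Integrate [weighted_square_crossing]. The factor [U k], the partial sum
    set to zero after the first crossing, depends on the first [k] variables only, so
    it is independent of [Z k] and the cross terms integrate to zero. *)
Lemma hajek_renyi (R : realType) (d : measure_display)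
    (T : measurableType d) (P : probability T R) (Z : nat -> {mfun T >-> R})
    (M c : nat -> R) (a : R) (n : nat) :
  independent_RVs P Z -> (forall i w, `|Z i w| <= M i) ->
  (forall i, \int[P]_w Z i w = 0) ->
  0 < a -> (forall k, 0 <= c k) -> (forall k, c k.+1 <= c k) ->
  (P [set w | exists2 k, (k <= n)%N & (a <= c k * (\sum_(i < k) Z i w) ^+ 2)%R] <=
   (a^-1 * \sum_(k < n) c k.+1 * \int[P]_w (Z k w ^+ 2))%R%:E)%E.
Proof.
move=> indZ ZM EZ a0 c0 cn.
pose S k w := \sum_(i < k) Z i w.
pose alive k w := uncrossed a (fun j => c j * S j w ^+ 2) k.
pose U k w := if alive k w then S k w else 0.
have M0 i : 0 <= M i by exact: le_trans (ZM i point).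
have SM k w : `|S k w| <= \sum_(i < k) M i.
  by apply: le_trans (ler_norm_sum _ _ _) _; apply: ler_sum.
have UM k w : `|U k w| <= \sum_(i < k) M i.
  by rewrite /U; case: ifP => // _; rewrite normr0 sumr_ge0.
pose G k := g_sigma_algebraType (prefix_cylinders Z k).
have mSG k j : (j <= k)%N -> measurable_fun setT (S j : G k -> R).
  move=> jk; apply: measurable_sum => i; apply: measurable_prefix.
  exact: leq_trans (ltn_ord i) jk.
have mUG k : measurable_fun setT (U k : G k -> R).
  apply: measurable_fun_ifT; last exact: measurable_cst.
    apply: (@measurable_uncrossed _ _ (G k)) => j jk.
    apply: measurable_funM; first exact: measurable_cst.
    by apply: measurable_funX; exact: mSG.
  exact: mSG.
have mG k A : measurable (A : set (G k)) -> measurable (A : set T).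
  apply: smallest_sub; first exact: sigma_algebra_measurable.
  exact: prefix_cylinders_measurable.
have mU k : measurable_fun setT (U k).
  by move=> _ B mB; apply: mG; exact: mUG.
have mA k : measurable_fun setT (alive k).
  move=> _ B mB; apply: (mG k.+1); apply: measurable_uncrossed => // j jk.
  apply: measurable_funM; first exact: measurable_cst.
  by apply: measurable_funX; apply: mSG; exact: leqW.
have UZ0 k : \int[P]_w (U k w * Z k w) = 0.
  rewrite (Rintegral_prod_independent (M := \sum_(i < k) M i) (N := M k))//.
    by rewrite EZ mulr0.
  move=> A B mAs mB; apply: (independent_past indZ (leqnn k)) => //.
  by rewrite -[X in <<s _ >> X]setTI; exact: mUG.
have iUZ k : P.-integrable setT (EFin \o (fun w => U k w * Z k w)).
  apply: (@bounded_integrable _ _ _ P _ ((\sum_(i < k) M i) * M k)).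
    exact: measurable_funM.
  by move=> w; rewrite normrM ler_pM.
have iZ2 k : P.-integrable setT (EFin \o (fun w => Z k w ^+ 2)).
  apply: (@bounded_integrable _ _ _ P _ (M k ^+ 2)).
    exact: measurable_funX.
  by move=> w; rewrite normrX lerXn2r// nnegrE.
pose F k w := c k.+1 * (2 * (U k w * Z k w) + Z k w ^+ 2).
have i2UZ k : P.-integrable setT (EFin \o (fun w => 2 * (U k w * Z k w))).
  exact: (integrableZl measurableT 2 (iUZ k)).
have iG k : P.-integrable setT
    (EFin \o (fun w => 2 * (U k w * Z k w) + Z k w ^+ 2)).
  exact: (integrableD measurableT (i2UZ k) (iZ2 k)).
have iF k : P.-integrable setT (EFin \o F k).
  exact: (integrableZl measurableT (c k.+1) (iG k)).
have EF k : \int[P]_w F k w = c k.+1 * \int[P]_w (Z k w ^+ 2).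
  by rewrite RintegralZl// RintegralD// RintegralZl// UZ0 mulr0 add0r.
have [iS ES] := Rintegral_sum (fun i (_ : (i < n)%N) => iF i).
set E := [set w | _].
have EE : E = alive n @^-1` [set false].
  apply/seteqP; split=> w /=.
    by move=> h; apply/negbTE; apply/uncrossedPn.
  by move/negbT/uncrossedPn.
have mE : measurable E by rewrite EE -[X in measurable X]setTI; exact: mA.
have key : (a%:E * P E <= (\sum_(k < n) \int[P]_w F k w)%:E)%E.
  rewrite -ES /Rintegral fineK; last exact: integrable_fin_num iS.
  have -> : P E = (\int[P]_w (\1_E w)%:E)%E by rewrite integral_indic// setIT.
  have iE : P.-integrable setT (EFin \o (\1_E : T -> R)).
    by apply: integrable_indic => //; rewrite ltey_eq fin_num_measure.
  rewrite -integralZl//; apply: le_integral => //.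
    exact: integrableZl.
  move=> w _; rewrite -EFinM lee_fin.
  have := @weighted_square_crossing _ a c (fun i => Z i w) n a0 c0 cn.
  rewrite -/(alive n w) => W; apply: le_trans W.
  rewrite indicE /=; case: ifPn => h.
    have -> : (w \in E) = false by apply: memNset; rewrite EE /= h.
    by rewrite mulr0 mulr_ge0// sqr_ge0.
  have -> : (w \in E) = true by apply: mem_set; rewrite EE /=; exact/negbTE.
  by rewrite mulr1.
have -> : (a^-1 * \sum_(k < n) c k.+1 * \int[P]_w (Z k w ^+ 2))%R%:E =
    ((a^-1)%:E * (\sum_(k < n) \int[P]_w F k w)%:E)%E.
  by rewrite -EFinM; congr (_ * _)%:E; apply: eq_bigr => k _; rewrite EF.
by rewrite lee_pdivlMl.
Qed.

(** * Crossing probabilities of normalized sums *)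

Lemma measurable_partial_sum (R : realType) (d : measure_display)
    (T : measurableType d) (Y : nat -> {mfun T >-> R}) (k : nat) :
  measurable_fun setT (fun w => \sum_(i < k) Y i w).
Proof. by apply: measurable_sum. Qed.

Lemma measurable_exists_ge (R : realType) (d : measure_display)
    (T : measurableType d) (u : nat -> T -> R) (b : nat -> R) (p : pred nat) :
  (forall k, measurable_fun setT (u k)) ->
  measurable [set w | exists2 k, p k & b k <= u k w].
Proof.
move=> mu; rewrite (_ : mkset _ =
    \bigcup_(k in [set k | p k]) [set w | b k <= u k w]); last first.
  by apply/seteqP; split => w [k ? ?]; exists k.
apply: bigcup_measurable => k _.
have := measurable_fun_ler (@measurable_cst _ _ _ _ setT (b k)) (mu k).
by move=> /(_ measurableT [set true] I); rewrite setTI.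
Qed.

(** Union bound, then [count_excess_le] under the common law. *)
Lemma probability_excess_le (R : realType) (d : measure_display)
    (T : measurableType d) (P : probability T R) (Y : nat -> {mfun T >-> R})
    (q delta : R) (m n : nat) :
  identically_distributed P Y ->
  (\int[P]_w (excess q m%:R (Y 0%N w))%:E <= delta%:E)%E ->
  (P (\big[setU/set0]_(i < n) [set w | ((maxn i.+1 m)%:R < `|Y i w| `^ q)%R])
    <= delta%:E)%E.
Proof.
move=> idY Edelta.
pose B (i : nat) := [set y : R | (maxn i.+1 m)%:R < `|y| `^ q].
have mB i : measurable (B i) by exact: measurable_gt_powR.
pose f (i : nat) w : R := (\1_(B i) (Y 0%N w)).
have fi i : P.-integrable setT (EFin \o f i).
  apply: (@bounded_integrable _ _ _ P _ 1).
    by apply: measurableT_comp => //; exact: measurable_indic.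
  by move=> w; rewrite /f indicE; case: (_ \in _); rewrite ?normr1 ?normr0.
have PB i : P (Y i @^-1` B i) = (\int[P]_w f i w)%:E.
  rewrite -[LHS]/(distribution P (Y i) (B i)) idY// /Rintegral fineK.
    rewrite (_ : (\int[P]_w (f i w)%:E =
        \int[P]_w (\1_(Y 0%N @^-1` B i) w)%:E)%E).
      by rewrite integral_indic ?setIT//; exact: measurable_funPTI.
    by apply: eq_integral => w _; rewrite /f !indicE; congr (_%:R%:E).
  exact: integrable_fin_num (fi i).
apply: (@le_trans _ _ (\sum_(i < n) P (Y i @^-1` B i))%E).
  apply: (Boole_inequality P (A := fun i => Y i @^-1` B i)) => i _.
  exact: measurable_funPTI.
rewrite (eq_bigr (fun i : 'I_n => (\int[P]_w f i w)%:E)); last first.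
  by move=> i _; exact: PB.
have [iS <-] : P.-integrable setT (EFin \o (fun w => \sum_(i < n) f i w)) /\
   (\int[P]_w (\sum_(i < n) f i w))%:E = (\sum_(i < n) (\int[P]_w f i w)%:E)%E.
  have [iS ES] := Rintegral_sum (fun i (_ : (i < n)%N) => fi i).
  by split => //; rewrite ES sumEFin.
rewrite lee_fin -[delta]mul1r -[1 * _]add0r.
apply: (Rintegral_le_excess (Y := Y 0%N) (q := q) (K := m%:R)) => // w.
rewrite add0r mul1r; apply: le_trans (count_excess_le _ _ _ n).
apply: ler_sum => i _; rewrite /f indicE /B.
by case: (boolP (_ < _)) => h; case: (boolP (_ \in _)) => //; rewrite inE /= (negbTE h).
Qed.

(** Since [Y] is centred, the mean of its truncation is minus the mean of the
    part cut off, which at level [t] is at most [t^(1/q - 1) * delta]. *)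
Lemma drift_le_centered (R : realType) (d : measure_display)
    (T : measurableType d) (P : probability T R) (Y : {mfun T >-> R})
    (q K delta : R) (m k : nat) :
  1 <= q -> (0 < m)%N -> K <= m%:R ->
  P.-integrable setT (EFin \o Y) -> \int[P]_w Y w = 0 ->
  (\int[P]_w (excess q K (Y w))%:E <= delta%:E)%E ->
  `|\sum_(i < k) \int[P]_w trunc q (maxn i.+1 m)%:R (Y w)| <=
  2 * q * delta * k%:R `^ q^-1.
Proof.
move=> q1 m0 Km iY EY Edelta; have q0 : 0 < q := lt_le_trans ltr01 q1.
have delta0 : 0 <= delta.
  rewrite -lee_fin (le_trans _ Edelta)// integral_ge0// => w _.
  by rewrite lee_fin excess_ge0.
pose t (i : nat) : R := (maxn i.+1 m)%:R.
have t0 i : 0 < t i by rewrite /t ltr0n leq_max.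
have iT i : P.-integrable setT (EFin \o (fun w => trunc q (t i) (Y w))).
  apply: (@bounded_integrable _ _ _ P _ (t i `^ q^-1)).
    by apply: measurableT_comp => //; exact: measurable_trunc.
  by move=> w; exact: normr_trunc.
have iD i : P.-integrable setT (EFin \o (fun w => Y w - trunc q (t i) (Y w))).
  exact: (integrableB measurableT iY (iT i)).
have bound i : `|\int[P]_w trunc q (t i) (Y w)| <= t i `^ (q^-1 - 1) * delta.
  have -> : \int[P]_w trunc q (t i) (Y w) =
      - \int[P]_w (Y w - trunc q (t i) (Y w)).
    by rewrite RintegralB// EY sub0r opprK.
  rewrite normrN; apply: (le_trans (le_normr_Rintegral measurableT (iD i))).
  rewrite -[leRHS]add0r; apply: (Rintegral_le_excess (Y := Y) (q := q) (K := K)) => //.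
  - exact: powR_ge0.
  - exact: integrable_norm.
  move=> w; rewrite add0r; apply: le_trans (normr_sub_trunc_le_excess _ q1 (t0 i)) _.
  by rewrite ler_wpM2l ?powR_ge0// excess_le// (le_trans Km)// ler_nat leq_maxr.
apply: (le_trans (ler_norm_sum _ _ _)).
apply: (@le_trans _ _ (\sum_(i < k) (i.+1%:R `^ (q^-1 - 1) * delta))).
  apply: ler_sum => i _; apply: (le_trans (bound i)); rewrite ler_wpM2r//.
  rewrite -(opprB 1) !powRN.
  have p0 := powR_gt0 (1 - q^-1) (t0 i).
  have p1 : 0 < i.+1%:R `^ (1 - q^-1) :> R by rewrite powR_gt0.
  rewrite lef_pV2 ?posrE//; apply: ge0_ler_powR; rewrite ?nnegrE ?(ltW (t0 i))//.
    by rewrite subr_ge0 invf_le1.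
  by rewrite ler_nat leq_maxl.
rewrite -mulr_suml.
have a1 : q^-1 <= 1 by rewrite invf_le1.
have a0 : 0 < q^-1 by rewrite invr_gt0.
apply: (le_trans (ler_wpM2r delta0 (sum_powR_le k a0 a1))).
by rewrite invrK mulrAC.
Qed.

(** For [q <= 1] the absolute value of the truncation at a level [t <= k] has
    mean at most [K^(1/q) + k^(1/q - 1) * delta]; sum [k] of these. *)
Lemma drift_le_uncentered (R : realType) (d : measure_display)
    (T : measurableType d) (P : probability T R) (Y : {mfun T >-> R})
    (q K delta : R) (m k : nat) :
  0 < q -> q <= 1 -> 0 <= K -> (0 < m)%N -> (m <= k)%N ->
  (\int[P]_w (excess q K (Y w))%:E <= delta%:E)%E ->
  `|\sum_(i < k) \int[P]_w trunc q (maxn i.+1 m)%:R (Y w)| <=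
  (K `^ q^-1 * m%:R `^ (- (q^-1 - 1)) + delta) * k%:R `^ q^-1.
Proof.
move=> q0 q1 K0 m0 mk Edelta.
have a1 : 0 <= q^-1 - 1 by rewrite subr_ge0 invf_ge1.
have delta0 : 0 <= delta.
  rewrite -lee_fin (le_trans _ Edelta)// integral_ge0// => w _.
  by rewrite lee_fin excess_ge0.
have mr : (0 : R) < m%:R by rewrite ltr0n.
have kr : (0 : R) < k%:R by rewrite ltr0n (leq_trans m0).
have bound (i : 'I_k) : `|\int[P]_w trunc q (maxn i.+1 m)%:R (Y w)| <=
    K `^ q^-1 + k%:R `^ (q^-1 - 1) * delta.
  have iT : P.-integrable setT
      (EFin \o (fun w => trunc q (maxn i.+1 m)%:R (Y w))).
    apply: (@bounded_integrable _ _ _ P _ ((maxn i.+1 m)%:R `^ q^-1)).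
      by apply: measurableT_comp => //; exact: measurable_trunc.
    by move=> w; exact: normr_trunc.
  apply: (le_trans (le_normr_Rintegral measurableT iT)).
  apply: (Rintegral_le_excess (Y := Y) (q := q) (K := K)) => //.
  - exact: integrable_norm.
  move=> w; apply: (le_trans (normr_trunc_le_excess _ _ q0 q1 K0)); rewrite lerD2l.
  rewrite ler_wpM2r ?excess_ge0//; apply: ge0_ler_powR; rewrite ?nnegrE ?ler0n//.
  by rewrite ler_nat geq_max mk ltn_ord.
apply: (le_trans (ler_norm_sum _ _ _)).
apply: (le_trans (ler_sum _ (fun i _ => bound i))).
have ka : k%:R * k%:R `^ (q^-1 - 1) = k%:R `^ q^-1 :> R.
  by rewrite mulr_powRB1// ?ltW// invr_gt0.
rewrite sumr_const card_ord -[leLHS]mulr_natl mulrDr mulrA ka.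
rewrite mulrDl [delta * _]mulrC lerD2r.
rewrite mulrC -mulrA ler_wpM2l ?powR_ge0//.
rewrite -ka mulrCA; apply: ler_peMr; first exact: ltW.
rewrite powRN ler_pdivlMl ?powR_gt0// mulr1.
apply: ge0_ler_powR => //; rewrite ?nnegrE ?(ltW mr) ?(ltW kr)// ler_nat//.
Qed.

(** A crossing requires either that some variable exceeds its truncation level,
    or, as the drift uses up at most half of the threshold, that the sums of the
    centred truncated variables cross the other half. *)
Lemma finite_crossing_le (R : realType) (d : measure_display)
    (T : measurableType d) (P : probability T R) (Y : nat -> {mfun T >-> R})
    (q K eps delta : R) (m n : nat) (r := 2 / q) :
  iid P Y -> 0 < q -> q < 2 -> 0 <= K -> (0 < m)%N -> K <= m%:R -> 0 < eps ->
  (\int[P]_w (excess q K (Y 0%N w))%:E <= delta%:E)%E ->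
  (forall k, (m <= k)%N ->
     `|\sum_(i < k) \int[P]_w trunc q (maxn i.+1 m)%:R (Y 0%N w)| <=
     eps / 2 * k%:R `^ q^-1) ->
  (P [set w | exists2 k, (m <= k <= n)%N &
        (eps * k%:R `^ q^-1 <= `|\sum_(i < k) Y i w|)%R]
   <= (delta + (eps / 2) ^- 2 *
        (r / (r - 1) * (K `^ r * m%:R `^ (1 - r)) + r / (r - 1) * delta))%R%:E)%E.
Proof.
move=> [indY idY] q0 q2 K0 m0 Km eps0 Edelta drift.
pose t (i : nat) : R := (maxn i.+1 m)%:R.
have t0 i : 0 < t i by rewrite /t ltr0n leq_max.
pose V i w := trunc q (t i) (Y i w).
pose e i := \int[P]_w V i w.
have mV i : measurable_fun setT (V i).
  by apply: measurableT_comp => //; exact: measurable_trunc.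
have VM i w : `|V i w| <= t i `^ q^-1 by exact: normr_trunc.
have iV i : P.-integrable setT (EFin \o V i).
  exact: bounded_integrable (mV i) (VM i).
have eE i : e i = \int[P]_w trunc q (t i) (Y 0%N w).
  apply: (ident_Rintegral (g := trunc q (t i)) (M := t i `^ q^-1)) => //.
    exact: measurable_trunc.
  by move=> y; exact: normr_trunc.
have mZ i : measurable_fun setT (fun w => V i w - e i).
  by apply: measurable_funB => //; exact: measurable_cst.
pose Z i := mfun_of (mZ i).
have indZ : independent_RVs P Z.
  apply: (@independent_RVs_comp _ _ _ _ _ _
    (fun i y => trunc q (t i) y - e i) indY) => // i.
  by apply: measurable_funB; [exact: measurable_trunc|exact: measurable_cst].
have ie i : P.-integrable setT (EFin \o (fun _ : T => e i)).
  exact: finite_measure_integrable_cst.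
have EZ i : \int[P]_w Z i w = 0.
  by rewrite RintegralB// Rintegral_probability_cst subrr.
have ZM i w : `|Z i w| <= t i `^ q^-1 + `|e i|.
  by apply: le_trans (ler_normB _ _) _; rewrite lerD2r.
have iV2 i : P.-integrable setT (EFin \o (fun w => V i w ^+ 2)).
  apply: (@bounded_integrable _ _ _ P _ ((t i `^ q^-1) ^+ 2)).
    exact: measurable_funX.
  by move=> w; rewrite normrX lerXn2r// nnegrE ?powR_ge0.
have varZ i : \int[P]_w (Z i w ^+ 2) <= \int[P]_w (V i w ^+ 2).
  have -> : \int[P]_w (Z i w ^+ 2) =
      \int[P]_w (V i w ^+ 2 + ((- (2 * e i)) * V i w + e i ^+ 2)).
    by apply: eq_Rintegral => w _ /=; ring.
  have i1 : P.-integrable setT (EFin \o (fun w => (- (2 * e i)) * V i w)).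
    exact: (integrableZl measurableT _ (iV i)).
  have i2 : P.-integrable setT (EFin \o (fun _ : T => e i ^+ 2)).
    exact: finite_measure_integrable_cst.
  have i3 : P.-integrable setT
      (EFin \o (fun w => (- (2 * e i)) * V i w + e i ^+ 2)).
    exact: (integrableD measurableT i1 i2).
  rewrite RintegralD// RintegralD// RintegralZl//.
  rewrite Rintegral_probability_cst -/(e i).
  by rewrite gerDl; nra.
pose c (k : nat) : R := (maxn k m)%:R `^ (- r).
have c0 k : 0 <= c k by exact: powR_ge0.
have r0 : 0 < r by rewrite divr_gt0.
have cn k : c k.+1 <= c k.
  rewrite /c !powRN.
  have mk j : 0 < (maxn j m)%:R :> R by rewrite ltr0n leq_max m0 orbT.
  rewrite lef_pV2 ?posrE ?powR_gt0//; apply: ge0_ler_powR; rewrite ?nnegrE//.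
    exact: ltW.
  by rewrite ler_nat geq_max !leq_max leqnSn leqnn orbT.
have a0 : 0 < (eps / 2) ^+ 2 by rewrite exprn_gt0// divr_gt0.
have HR := hajek_renyi n indZ ZM EZ a0 c0 cn.
pose A := [set w | exists2 k, (k <= n)%N &
  (eps / 2) ^+ 2 <= c k * (\sum_(i < k) Z i w) ^+ 2].
pose D := \big[setU/set0]_(i < n) [set w | (maxn i.+1 m)%:R < `|Y i w| `^ q].
have mD : measurable D.
  apply: bigsetU_measurable => i _.
  exact: (measurable_funPTI (Y i) (measurable_gt_powR q _)).
have mA : measurable A.
  apply: (@measurable_exists_ge _ _ _
    (fun k w => c k * (\sum_(i < k) Z i w) ^+ 2)
    (fun=> (eps / 2) ^+ 2) (fun k => (k <= n)%N)) => k.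
  apply: measurable_funM; first exact: measurable_cst.
  by apply: measurable_funX; exact: measurable_partial_sum.
set E := [set w | _].
have mE : measurable E.
  apply: (@measurable_exists_ge _ _ _ (fun k w => `|\sum_(i < k) Y i w|)
    (fun k => eps * k%:R `^ q^-1) (fun k => (m <= k <= n)%N)) => k.
  by apply: measurableT_comp => //; exact: measurable_partial_sum.
have sub : E `<=` D `|` A.
  move=> w [k /andP[mk kn] hk].
  have [wD|nD] := pselect (D w); [by left|right].
  exists k => //.
  have YV : \sum_(i < k) Y i w = \sum_(i < k) Z i w + \sum_(i < k) e i.
    rewrite -big_split /=; apply: eq_bigr => i _ /=.
    rewrite subrK /V /trunc; case: ifPn => //; rewrite -ltNge => h.
    exfalso; apply: nD.
    rewrite /D -(bigcup_mkord n (fun i => [set w | (maxn i.+1 m)%:R < `|Y i w| `^ q])).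
    exists (i : nat) => //=.
    exact: leq_trans (ltn_ord i) kn.
  have k0 : (0 < k)%N := leq_trans m0 mk.
  have kr : (0 : R) < k%:R by rewrite ltr0n.
  have eb := drift k mk.
  rewrite (eq_bigr (fun i : 'I_k => e i)) in eb; last by move=> i _; rewrite eE.
  have big : eps / 2 * k%:R `^ q^-1 <= `|\sum_(i < k) Z i w|.
    have tri := ler_normD (\sum_(i < k) Z i w) (\sum_(i < k) e i).
    rewrite -YV in tri; lra.
  have ck : c k = ((k%:R `^ q^-1) ^+ 2)^-1.
    rewrite /c (maxn_idPl mk) powRN; congr (_^-1).
    by rewrite -powR_mulrn ?powR_ge0// -powRrM mulrC.
  have kp : 0 < k%:R `^ q^-1 :> R by exact: powR_gt0.
  rewrite ck ler_pdivlMl ?exprn_gt0// -exprMn mulrC -[leRHS]real_normK ?num_real//.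
  by rewrite lerXn2r ?nnegrE// mulr_ge0// ltW// divr_gt0.
apply: (@le_trans _ _ (P (D `|` A))).
  by apply: le_measure => //; rewrite inE//; exact: measurableU.
apply: (le_trans (measureU2 P mD mA)).
rewrite EFinD; apply: leeD.
  rewrite /D; apply: (@probability_excess_le _ _ _ P Y q delta m n idY).
  apply: le_trans Edelta; apply: ge0_le_integral => //.
  - by move=> w _; rewrite lee_fin excess_ge0.
  - by apply/measurable_EFinP; apply: measurableT_comp => //; exact: measurable_excess.
  - by apply/measurable_EFinP; apply: measurableT_comp => //; exact: measurable_excess.
  - by move=> w _; rewrite lee_fin excess_le.
apply: (le_trans HR); rewrite lee_fin ler_wpM2l//; first by rewrite invr_ge0 ltW.
apply: (@le_trans _ _ (\sum_(k < n)
    \int[P]_w (c k.+1 * trunc q (t k) (Y 0%N w) ^+ 2))).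
  apply: ler_sum => k _.
  have mT : measurable_fun setT (fun w => trunc q (t k) (Y 0%N w)).
    by apply: measurableT_comp => //; exact: measurable_trunc.
  rewrite RintegralZl//; last first.
    apply: (@bounded_integrable _ _ _ P _ ((t k `^ q^-1) ^+ 2)).
      exact: measurable_funX.
    by move=> w; rewrite normrX lerXn2r// ?nnegrE ?powR_ge0// normr_trunc.
  rewrite ler_wpM2l//; apply: (le_trans (varZ k)).
  rewrite (@ident_Rintegral _ _ _ P Y (fun y => trunc q (t k) y ^+ 2)
    ((t k `^ q^-1) ^+ 2) k)//.
    by apply: measurable_funX; exact: measurable_trunc.
  by move=> y; rewrite normrX lerXn2r// ?nnegrE ?powR_ge0// normr_trunc.
have iF (k : nat) : P.-integrable setT
    (EFin \o (fun w => c k.+1 * trunc q (t k) (Y 0%N w) ^+ 2)).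
  apply: (@bounded_integrable _ _ _ P _ (c k.+1 * (t k `^ q^-1) ^+ 2)).
    apply: measurable_funM; first exact: measurable_cst.
    apply: measurable_funX.
    by apply: measurableT_comp => //; exact: measurable_trunc.
  move=> w; rewrite normrM (ger0_norm (c0 _)) ler_wpM2l//.
  by rewrite normrX lerXn2r// ?nnegrE ?powR_ge0// normr_trunc.
have [iS <-] := Rintegral_sum (fun k (_ : (k < n)%N) => iF k).
apply: (Rintegral_le_excess (Y := Y 0%N) (q := q) (K := K)) => //.
  have r1 : 1 < r by rewrite /r ltr_pdivlMr// mul1r.
  by rewrite divr_ge0// ?subr_ge0 ltW.
by move=> w; exact: variance_sum_le.
Qed.

(** Removes the upper bound on time by continuity from below. *)
Lemma infinite_crossing_le (R : realType) (d : measure_display)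
    (T : measurableType d) (P : probability T R) (u : nat -> T -> R)
    (b : nat -> R) (m : nat) (B : \bar R) :
  (forall k, measurable_fun setT (u k)) ->
  (forall n, (P [set w | exists2 k, (m <= k <= n)%N & (b k <= u k w)%R] <= B)%E) ->
  (P [set w | exists2 k, (m <= k)%N & (b k <= u k w)%R] <= B)%E.
Proof.
move=> mu PB.
pose E n := [set w | exists2 k, (m <= k <= n)%N & b k <= u k w].
have mE n : measurable (E n).
  exact: (measurable_exists_ge b (fun k => m <= k <= n)%N mu).
have -> : [set w | exists2 k, (m <= k)%N & b k <= u k w] = \bigcup_n E n.
  apply/seteqP; split => w /=.
    by move=> [k mk bk]; exists k => //; exists k => //; rewrite mk leqnn.
  by move=> [n _ [k /andP[mk _] bk]]; exists k.
have cE : P \o E @ \oo --> P (\bigcup_n E n).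
  apply: nondecreasing_cvg_mu => //; first exact: bigcupT_measurable.
  move=> i j ij; apply/subsetPset => w [k /andP[mk ki] bk]; exists k => //.
  by rewrite mk (leq_trans ki).
rewrite -(cvg_lim _ cE)//; apply: lime_le; first by apply/cvg_ex; eexists; exact: cE.
by apply: nearW => n; exact: PB.
Qed.

(** * From crossing probabilities back to the excess *)

Lemma prod_onem_le (R : realType) (p : nat -> R) (s : seq nat) :
  (forall i, 0 <= p i <= 1) ->
  \prod_(i <- s) (1 - p i) * (1 + \sum_(i <- s) p i) <= 1.
Proof.
move=> p01; elim: s => [|i s IH]; first by rewrite !big_nil addr0 mulr1.
rewrite !big_cons; have /andP[p0 p1] := p01 i.
have S0 : 0 <= \sum_(j <- s) p j by rewrite sumr_ge0// => j _; case/andP: (p01 j).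
have P0 : 0 <= \prod_(j <- s) (1 - p j).
  by rewrite prodr_ge0// => j _; rewrite subr_ge0; case/andP: (p01 j).
apply: le_trans IH; rewrite mulrAC mulrC ler_wpM2l//.
nra.
Qed.

(** By independence the probability that none of the events occurs is the
    product of the [1 - p i], which is at most the inverse of one plus the sum
    of the [p i]; it is also at least [1 - a], and [1 - a >= 1 / 2]. *)
Lemma borel_cantelli_sum_le (R : realType) (d : measure_display)
    (T : measurableType d) (P : probability T R) (Y : nat -> {mfun T >-> R})
    (B : nat -> set R) (a : R) (m n : nat) :
  independent_RVs P Y -> (forall i, measurable (B i)) -> a <= 1 / 2 ->
  (P [set w | exists2 i, (m <= i)%N & B i (Y i w)] <= a%:E)%E ->
  \sum_(i <- iota m n) fine (P (Y i @^-1` B i)) <= 2 * a.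
Proof.
move=> indY mB a2 Pa.
pose p i := fine (P (Y i @^-1` B i)).
have mYB i : measurable (Y i @^-1` B i) by exact: measurable_funPTI.
have p01 i : 0 <= p i <= 1.
  rewrite fine_ge0//= -lee_fin fineK ?fin_num_measure//.
  exact: probability_le1.
have S0 : 0 <= \sum_(j <- iota m n) p j.
  by rewrite sumr_ge0// => j _; case/andP: (p01 j).
have mC i : measurable (~` B i) by exact: measurableC.
have PC i : P (Y i @^-1` (~` B i)) = (1 - p i)%:E.
  by rewrite -preimage_setC probability_setC// EFinB fineK// fin_num_measure.
have ind := indY (iota m n) (fun i => ~` B i) (iota_uniq _ _) mC.
rewrite (eq_bigr _ (fun i _ => PC i)) prodEFin in ind.
set N := \bigcap_(i in _) _ in ind.
have mN : measurable N.
  apply: fin_bigcap_measurable => [|i _]; first exact: finite_seq.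
  exact: measurable_funPTI.
set E := [set w | _] in Pa.
have mE : measurable E.
  have -> : E = \bigcup_(i in [set i | (m <= i)%N]) (Y i @^-1` B i).
    by apply/seteqP; split => w [i mi Bi]; exists i.
  by apply: bigcup_measurable => i _.
have : (P (~` E) <= P N)%E.
  apply: le_measure; rewrite ?inE//; first exact: measurableC.
  move=> w nE i; rewrite /= mem_iota => /andP[mi _] Bi.
  by apply: nE; exists i.
rewrite probability_setC// ind => PN.
have : 1 - a <= \prod_(i <- iota m n) (1 - p i).
  rewrite -lee_fin; apply: le_trans PN; rewrite EFinB leeB//.
have := prod_onem_le (iota m n) p01.
rewrite -/(p _); set S := \sum_(_ <- _) _ in S0 *; set Q := \prod_(_ <- _) _.
move=> h1 h2; have : (1 - a) * (1 + S) <= 1.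
  by apply: le_trans h1; rewrite ler_wpM2r// addr_ge0.
have h3 : 0 <= (1 / 2 - a) * S by rewrite mulr_ge0// subr_ge0.
by move=> h4; nra.
Qed.

(** If [x = |Y w|^q > t], the number of [i >= m] with [i + 1 <= x] is more than
    [x - 1 - m], and this is at least [x / 2] because [t >= 2 * (m + 1)]. *)
Lemma integral_excess_le (R : realType) (d : measure_display)
    (T : measurableType d) (P : probability T R) (Y : {mfun T >-> R})
    (q t b : R) (m : nat) :
  2 * m.+1%:R <= t ->
  (forall n, \sum_(i <- iota m n) fine (P [set w | i.+1%:R <= `|Y w| `^ q]) <= b) ->
  (\int[P]_w (excess q t (Y w))%:E <= (2 * b)%:E)%E.
Proof.
move=> mt Sb.
pose A i := [set w | (m + i).+1%:R <= `|Y w| `^ q].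
have mA i : measurable (A i).
  exact: (measurable_funPTI Y (measurable_ge_powR q (m + i).+1%:R)).
pose g i w : \bar R := (2 * \1_(A i) w)%:E.
have g0 i w : (0 <= g i w)%E by rewrite lee_fin mulr_ge0.
have mg i : measurable_fun setT (g i).
  apply/measurable_EFinP; apply: measurable_funM; first exact: measurable_cst.
  exact: measurable_indic.
have Ig i : (\int[P]_w g i w = (2 * fine (P (A i)))%:E)%E.
  rewrite /g; under eq_integral do rewrite EFinM.
  rewrite ge0_integralZl//; last by apply/measurable_EFinP; exact: measurable_indic.
  by rewrite integral_indic// setIT EFinM fineK// fin_num_measure.
apply: (@le_trans _ _ (\int[P]_w (\sum_(i <oo) g i w))%E).
  apply: ge0_le_integral => //.
  - by move=> w _; rewrite lee_fin excess_ge0.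
  - by apply/measurable_EFinP; apply: measurableT_comp => //; exact: measurable_excess.
  - by apply: ge0_emeasurable_sum.
  move=> w _; rewrite /excess; set x := `|Y w| `^ q.
  case: ifPn => [tx|_]; last by apply: nneseries_ge0.
  have x0 : 0 <= x by exact: powR_ge0.
  have /andP[x1 x2] := truncn_itv x0.
  set N := Num.truncn x in x1 x2.
  apply: le_trans (nneseries_lim_ge (N - m) _); last by move=> *; exact: g0.
  rewrite (eq_big_nat _ _ (F2 := fun=> 2%:E)); last first.
    move=> i /andP[_ iN]; rewrite /g indicE mem_set ?mulr1//.
    rewrite /A /= -/x; apply: le_trans x1; rewrite ler_nat.
    by move: iN; rewrite ltn_subRL.
  rewrite sumEFin lee_fin sumr_const_nat subn0 -mulr_natl.
  have NR : (N - m)%:R >= N%:R - m%:R :> R.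
    by rewrite lerBlDr -natrD ler_nat addnC -leq_subLR.
  rewrite -natr1 in x2; rewrite -natr1 in mt; lra.
rewrite integral_nneseries//.
apply: lime_le; first by apply: is_cvg_nneseries => i _ _; exact: integral_ge0.
apply: nearW => n; rewrite (eq_bigr _ (fun i _ => Ig i)) sumEFin lee_fin -mulr_sumr.
rewrite ler_pM2l//; apply: le_trans (Sb n).
by rewrite -{1}[m]addn0 iotaDl big_map /index_iota subn0.
Qed.

(** * Uniform convergence over a family of probabilities *)

(** The family must be nonempty since the supremum of the empty set is
    [-oo]. *)
Lemma ereal_sup_cvg0P (R : realType) (I U : Type) (PP : set I)
    (F : set_system U) (FF : ProperFilter F) (f : U -> I -> \bar R) :
  (forall u i, 0 <= f u i)%E ->
  (ereal_sup [set f u i | i in PP] @[u --> F] --> 0%E) <->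
  (PP !=set0 /\ forall eta : R, 0 < eta ->
     \forall u \near F, forall i, PP i -> (f u i <= eta%:E)%E).
Proof.
move=> f0; split => [/fine_cvgP[fin cv]|[[i0 Pi0] H]].
  split.
    apply/set0P/negP => /eqP PP0; apply: (filter_not_empty F).
    apply: filterS fin => u; rewrite PP0 image_set0 ereal_sup0//.
  move=> eta eta0; have /cvgrPdist_le/(_ _ eta0) := cv.
  apply: filterS2 fin => u fu; rewrite sub0r normrN => h i Pi.
  apply: (@le_trans _ _ (ereal_sup [set f u i | i in PP])).
    by apply: ereal_sup_ubound; exists i.
  by rewrite -(fineK fu) lee_fin (le_trans (ler_norm _)).
have bnd (eta : R) : 0 < eta -> \forall u \near F,
    (0 <= ereal_sup [set f u i | i in PP] <= eta%:E)%E.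
  move=> eta0; apply: filterS (H eta eta0) => u h; apply/andP; split.
    by apply: (le_trans (f0 u i0)); apply: ereal_sup_ubound; exists i0.
  by apply: ge_ereal_sup => _ [i Pi <-]; exact: h.
apply/fine_cvgP; split.
  apply: filterS (bnd 1 ltr01) => u /andP[h0 h1].
  by rewrite ge0_fin_numE// (le_lt_trans h1)// ltry.
apply/cvgrPdist_le => eta eta0; apply: filterS (bnd eta eta0) => u /andP[h0 h1].
have fu : ereal_sup [set f u i | i in PP] \is a fin_num.
  by rewrite ge0_fin_numE// (le_lt_trans h1)// ltry.
by rewrite sub0r normrN ger0_norm ?fine_ge0// -lee_fin fineK.
Qed.

Definition recenter (R : realType) (d : measure_display) (T : measurableType d)
    (X : nat -> {mfun T >-> R}) (c : R) (i : nat) : {mfun T >-> R} :=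
  mfun_of (measurable_funB (@measurable_funPT _ _ _ _ (X i))
             (@measurable_cst _ _ _ _ setT c)).

Lemma iid_recenter (R : realType) (d : measure_display) (T : measurableType d)
    (P : probability T R) (X : nat -> {mfun T >-> R}) (c : R) :
  iid P X -> iid P (recenter X c).
Proof.
move=> [indX idX].
have mc : measurable_fun setT (fun y : R => y - c).
  by apply: measurable_funB; [exact: measurable_id|exact: measurable_cst].
split; first exact: (independent_RVs_comp (g := fun _ y => y - c) indX).
move=> n B mB; have mcB : measurable ((fun y => y - c) @^-1` B).
  by rewrite -[X in measurable X]setTI; exact: mc.
exact: (idX n _ mcB).
Qed.

Lemma unif_integrableP (R : realType) (d : measure_display)
    (T : measurableType d) (PP : set (probability T R)) (q : R)
    (X : nat -> {mfun T >-> R})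
    (Y := fun P : probability T R => recenter X (centering P q (X 0%N))) :
  unif_integrable PP q (X 0%N) <->
  (PP !=set0 /\ forall eta : R, 0 < eta -> \forall t \near +oo,
     forall P, PP P -> (\int[P]_w (excess q t (Y P 0%N w))%:E <= eta%:E)%E).
Proof.
rewrite -ereal_sup_cvg0P; last first.
  by move=> t P; apply: integral_ge0 => w _; rewrite lee_fin excess_ge0.
rewrite /unif_integrable.
suff E (t : R) (P : probability T R) :
    ('E_P[(fun w => `|X 0%N w - centering P q (X 0%N)| `^ q *
      \1_[set v | t < `|X 0%N v - centering P q (X 0%N)| `^ q] w)%R] =
     \int[P]_w (excess q t (Y P 0%N w))%:E)%E.
  by under eq_fun do under eq_imagel do rewrite E.
rewrite unlock; apply: eq_integral => w _; congr EFin.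
rewrite indicE /excess /=.
by case: ifPn => h; [rewrite mem_set ?mulr1|rewrite memNset ?mulr0//=; exact/negP].
Qed.

Lemma measurable_esups_event (R : realType) (d : measure_display)
    (T : measurableType d) (u : nat -> T -> R) (eps : R) (m : nat) :
  (forall k, measurable_fun setT (u k)) ->
  measurable [set w | (eps%:E <= esups (fun k => `|u k w|%:E) m)%E].
Proof.
move=> mu.
have ms : measurable_fun setT (fun w => esups (fun k => `|u k w|%:E) m).
  apply: measurable_fun_esups => k.
  by apply/measurable_EFinP; apply: measurableT_comp => //; exact: normr_measurable.
have := emeasurable_fun_c_infty measurableT ms eps%:E.
by rewrite setTI.
Qed.

Definition normalized_sum (R : realType) (d : measure_display)
    (T : measurableType d) (q : R) (Y : nat -> {mfun T >-> R}) (k : nat)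
    (w : T) : R :=
  (k%:R `^ q^-1)^-1 * \sum_(i < k) Y i w.

Lemma measurable_normalized_sum (R : realType) (d : measure_display)
    (T : measurableType d) (q : R) (Y : nat -> {mfun T >-> R}) (k : nat) :
  measurable_fun setT (normalized_sum q Y k).
Proof.
apply: measurable_funM; first exact: measurable_cst.
exact: measurable_partial_sum.
Qed.

Lemma normr_normalized_sum (R : realType) (d : measure_display)
    (T : measurableType d) (q : R) (Y : nat -> {mfun T >-> R}) (k : nat)
    (w : T) (b : R) : (0 < k)%N ->
  (b <= `|normalized_sum q Y k w|) = (b * k%:R `^ q^-1 <= `|\sum_(i < k) Y i w|).
Proof.
move=> k0; have kp : (0 : R) < k%:R `^ q^-1 by rewrite powR_gt0// ltr0n.
by rewrite /normalized_sum normrM normfV (gtr0_norm kp) mulrC ler_pdivlMr.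
Qed.

Lemma vanishes_uniformly_asP (R : realType) (d : measure_display)
    (T : measurableType d) (PP : set (probability T R))
    (Z : probability T R -> nat -> T -> R) :
  vanishes_uniformly_as PP Z <->
  forall eps : R, 0 < eps -> PP !=set0 /\ forall eta : R, 0 < eta ->
     \forall m \near \oo, forall P, PP P ->
       (P [set w | (eps%:E <= esups (fun k => `|Z P k w|%:E) m)%E] <= eta%:E)%E.
Proof.
split => H eps eps0.
  by apply/ereal_sup_cvg0P; [move=> *; exact: measure_ge0|exact: H].
by apply/ereal_sup_cvg0P; [move=> *; exact: measure_ge0|exact: H].
Qed.

Lemma Rintegral_centering (R : realType) (d : measure_display)
    (T : measurableType d) (P : probability T R) (X : nat -> {mfun T >-> R})
    (q : R) : 1 <= q -> P.-integrable setT (EFin \o X 0%N) ->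
  P.-integrable setT (EFin \o recenter X (centering P q (X 0%N)) 0%N) /\
  \int[P]_w recenter X (centering P q (X 0%N)) 0%N w = 0.
Proof.
move=> q1 iX.
have cE : centering P q (X 0%N) = \int[P]_w X 0%N w.
  by rewrite /centering q1 /real_expectation unlock.
set c := centering _ _ _ in cE *.
have ic : P.-integrable setT (EFin \o (fun _ : T => c)).
  exact: finite_measure_integrable_cst.
split; first exact: (integrableB measurableT iX ic).
by rewrite (RintegralB measurableT iX ic) Rintegral_probability_cst cE subrr.
Qed.

(** * The uniform strong law *)

(** Choose [delta] from [eps] and [eta], then the level [K] from [delta], and
    only then the horizon [m], whose negative powers must offset those of [K]. *)
Lemma vanishes_of_unif_integrable (R : realType) (d : measure_display)
    (T : measurableType d) (PP : set (probability T R))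
    (X : nat -> {mfun T >-> R}) (q : R)
    (Y := fun P : probability T R => recenter X (centering P q (X 0%N))) :
  (forall P, PP P -> iid P X) -> 0 < q -> q < 2 ->
  (1 <= q -> forall P, PP P -> P.-integrable setT (EFin \o X 0%N)) ->
  unif_integrable PP q (X 0%N) ->
  vanishes_uniformly_as PP (fun P => normalized_sum q (Y P)).
Proof.
move=> hiid q0 q2 hint /unif_integrableP[PP0 UI].
apply/vanishes_uniformly_asP => eps eps0; split=> // eta eta0.
pose r := 2 / q; pose C := r / (r - 1); pose G := (eps / 2 / 2) ^- 2.
have r1 : 1 < r by rewrite /r ltr_pdivlMr// mul1r.
have C0 : 0 <= C by rewrite /C divr_ge0// ?subr_ge0 ltW// (lt_trans ltr01).
have G0 : 0 <= G by rewrite invr_ge0 exprn_ge0// !divr_ge0// ltW.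
have GC0 : 0 <= G * C by rewrite mulr_ge0.
pose delta := Num.min (eps / 16) (eta / (3 * (G * C + 1))).
have D0 : 0 < 3 * (G * C + 1) by rewrite mulr_gt0// ltr_wpDl.
have delta0 : 0 < delta by rewrite lt_min !divr_gt0.
have delta1 : delta <= eps / 16 by rewrite ge_min lexx.
have delta2 : delta * (3 * (G * C + 1)) <= eta.
  by rewrite -ler_pdivlMr// ge_min lexx orbT.
have [K [K0 UIK]] : exists K : R, 0 <= K /\ forall P, PP P ->
    (\int[P]_w (excess q K (Y P 0%N w))%:E <= delta%:E)%E.
  apply: (@filter_ex _ (+oo : set_system R)).
  by apply: filterI; [exact: nbhs_pinfty_ge (num_real 0)|exact: UI].
have eps8 : 0 < eps / 8 by rewrite divr_gt0.
have eta3 : 0 < eta / 3 by rewrite divr_gt0.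
have driftnear : \forall m \near \oo,
    q < 1 -> K `^ q^-1 * m%:R `^ (- (q^-1 - 1)) <= eps / 8.
  have [q1|q1] := ltP q 1; last by apply: nearW.
  have a0 : 0 < q^-1 - 1 by rewrite subr_gt0 invf_gt1.
  by apply: filterS (near_infty_powR_small (K `^ q^-1) a0 eps8) => m h _.
near=> m => P PPP.
have m0 : (0 < m)%N by near: m; exact: nbhs_infty_gt.
have Km : K <= m%:R by near: m; exact: nbhs_infty_ger.
have varsmall : (G * C * K `^ r) * m%:R `^ (- (r - 1)) <= eta / 3.
  by near: m; apply: near_infty_powR_small => //; rewrite subr_gt0.
have driftsmall : q < 1 -> K `^ q^-1 * m%:R `^ (- (q^-1 - 1)) <= eps / 8.
  by near: m.
have drift k : (m <= k)%N ->
    `|\sum_(i < k) \int[P]_w trunc q (maxn i.+1 m)%:R (Y P 0%N w)| <=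
    eps / 2 / 2 * k%:R `^ q^-1.
  move=> mk; have [q1|q1] := leP 1 q.
    have [iY EY] := Rintegral_centering q1 (hint q1 P PPP).
    apply: (le_trans (drift_le_centered k q1 m0 Km iY EY (UIK P PPP))).
    rewrite ler_wpM2r ?powR_ge0//; nra.
  apply: (le_trans (drift_le_uncentered q0 (ltW q1) K0 m0 mk (UIK P PPP))).
  rewrite ler_wpM2r ?powR_ge0//; have := driftsmall q1; lra.
have eps2 : 0 < eps / 2 by rewrite divr_gt0.
have mu k : measurable_fun setT (fun w => `|\sum_(i < k) Y P i w|).
  apply: measurableT_comp; first exact: normr_measurable.
  exact: measurable_partial_sum.
have main := infinite_crossing_le mu (fun n => finite_crossing_le n (iid_recenter _ (hiid P PPP))
  q0 q2 K0 m0 Km eps2 (UIK P PPP) drift).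
apply: (@le_trans _ _ (P [set w | exists2 k, (m <= k)%N &
    eps / 2 * k%:R `^ q^-1 <= `|\sum_(i < k) Y P i w|])).
  apply: le_measure; rewrite ?inE.
  - by apply: measurable_esups_event => k; exact: measurable_normalized_sum.
  - exact: measurable_exists_ge.
  move=> w /= h.
  (* a supremum of at least [eps] need not be attained, hence the loss of a half *)
  have /ereal_sup_gt[_ [k /= mk <-]] :
      ((eps / 2)%:E < esups (fun k => `|normalized_sum q (Y P) k w|%:E) m)%E.
    by apply: lt_le_trans h; rewrite lte_fin ltr_pdivrMr// ltr_pMr// ltr1n.
  rewrite lte_fin => /ltW hk; exists k => //.
  by rewrite -(@normr_normalized_sum _ _ _ q (Y P) k w (eps / 2) (leq_trans m0 mk)).
apply: (le_trans main); rewrite lee_fin.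
have -> : 1 - (2 / q) = - (r - 1) by rewrite opprB.
rewrite -/r -/C -/G.
have -> : G * (C * (K `^ r * m%:R `^ (- (r - 1))) + C * delta) =
    G * C * K `^ r * m%:R `^ (- (r - 1)) + G * C * delta by ring.
move: varsmall; set x := G * C * K `^ r * _ => varsmall.
nra.
Unshelve. all: by end_near. Qed.

(** If [|Y i|^q >= i + 1], then [|Y i| >= (i + 1)^(1/q)] is at most the sum of
    the absolute values of the partial sums before and after adding [Y i], so
    one of them is at least half of [(i + 1)^(1/q)]. *)
Lemma vanishes_excess_le (R : realType) (d : measure_display)
    (T : measurableType d) (P : probability T R) (Y : nat -> {mfun T >-> R})
    (q a t : R) (m : nat) :
  iid P Y -> 0 < q -> (0 < m)%N -> a <= 1 / 2 -> 2 * m.+1%:R <= t ->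
  (P [set w | ((1 / 2)%:E <= esups (fun k => `|normalized_sum q Y k w|%:E) m)%E]
     <= a%:E)%E ->
  (\int[P]_w (excess q t (Y 0%N w))%:E <= (2 * (2 * a))%:E)%E.
Proof.
move=> [indY idY] q0 m0 a2 mt Pa.
apply: (integral_excess_le mt) => n.
pose B (i : nat) := [set y : R | i.+1%:R <= `|y| `^ q].
have mB i : measurable (B i) by exact: measurable_ge_powR.
rewrite (eq_bigr (fun i => fine (P (Y i @^-1` B i)))); last first.
  by move=> i _; congr fine; apply/esym; exact: (idY i _ (mB i)).
apply: (borel_cantelli_sum_le n indY mB a2); apply: le_trans Pa.
apply: le_measure; rewrite ?inE.
- rewrite (_ : mkset _ = \bigcup_(i in [set i | (m <= i)%N]) (Y i @^-1` B i)).
    by apply: bigcup_measurable => i _; exact: measurable_funPTI.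
  by apply/seteqP; split => w [i mi Bi]; exists i.
- by apply: measurable_esups_event => k; exact: measurable_normalized_sum.
move=> w [i mi Bi] /=.
suff [k mk hk] : exists2 k, (m <= k)%N & 1 / 2 <= `|normalized_sum q Y k w|.
  apply: (@le_trans _ _ `|normalized_sum q Y k w|%:E); first by rewrite lee_fin.
  by apply: ereal_sup_ubound; exists k.
have i0 : (0 < i)%N := leq_trans m0 mi.
have Yi : i.+1%:R `^ q^-1 <= `|Y i w|.
  rewrite -[leRHS](@powR_invK _ q) ?gt_eqF//.
  by apply: ge0_ler_powR; rewrite ?nnegrE ?powR_ge0// invr_ge0 ltW.
have ii : i%:R `^ q^-1 <= i.+1%:R `^ q^-1 :> R.
  by apply: ge0_ler_powR; rewrite ?nnegrE ?ler_nat// invr_ge0 ltW.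
have [h|h] := leP (1 / 2 * i.+1%:R `^ q^-1) `|\sum_(j < i.+1) Y j w|.
  by exists i.+1; [exact: leqW|rewrite normr_normalized_sum].
exists i => //; rewrite normr_normalized_sum//.
have E : Y i w = \sum_(j < i.+1) Y j w - \sum_(j < i) Y j w.
  by rewrite big_ord_recr /= addrAC subrr add0r.
have := ler_normB (\sum_(j < i.+1) Y j w) (\sum_(j < i) Y j w).
rewrite -E; lra.
Qed.

Lemma unif_integrable_of_vanishes (R : realType) (d : measure_display)
    (T : measurableType d) (PP : set (probability T R))
    (X : nat -> {mfun T >-> R}) (q : R)
    (Y := fun P : probability T R => recenter X (centering P q (X 0%N))) :
  (forall P, PP P -> iid P X) -> 0 < q ->
  vanishes_uniformly_as PP (fun P => normalized_sum q (Y P)) ->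
  unif_integrable PP q (X 0%N).
Proof.
move=> hiid q0 /vanishes_uniformly_asP V; apply/unif_integrableP.
have half0 : 0 < 1 / 2 :> R by rewrite divr_gt0.
have [PP0 V2] := V _ half0.
split => // eta eta0.
pose a := Num.min (1 / 2) (eta / 4).
have a0 : 0 < a by rewrite lt_min !divr_gt0.
have a2 : a <= 1 / 2 by rewrite ge_min lexx.
have a4 : a <= eta / 4 by rewrite ge_min lexx orbT.
have [m [m0 Hm]] := filter_ex (filterI (nbhs_infty_gt 0) (V2 a a0)).
near=> t => P PPP.
have mt : 2 * m.+1%:R <= t by near: t; apply: nbhs_pinfty_ge; exact: num_real.
apply: (le_trans (vanishes_excess_le (iid_recenter _ (hiid P PPP)) q0 m0 a2 mt (Hm P PPP))).
rewrite lee_fin; lra.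
Unshelve. all: by end_near. Qed.

Theorem theorem1 (R : realType) (d : measure_display) (T : measurableType d)
    (PP : set (probability T R)) (X : nat -> {mfun T >-> R}) (q : R)
    (hiid : forall P : probability T R, PP P -> iid P X)
    (q_gt0 : 0 < q) (q_lt2 : q < 2)
    (hint : 1 <= q -> forall P : probability T R, PP P ->
       P.-integrable setT (EFin \o X 0%N)) :
  [/\ (1 <= q -> unif_integrable PP q (X 0%N) ->
        vanishes_uniformly_as PP (fun P k w =>
          (k%:R `^ q^-1)^-1 * \sum_(i < k) (X i w - real_expectation P (X 0%N)))),
      (q < 1 -> unif_integrable PP q (X 0%N) ->
        vanishes_uniformly_as PP (fun P k w =>
          (k%:R `^ q^-1)^-1 * \sum_(i < k) X i w)),
      (~ unif_integrable PP q (X 0%N) ->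
        ~ vanishes_uniformly_as PP (fun P k w =>
          (k%:R `^ q^-1)^-1 * \sum_(i < k) (X i w - centering P q (X 0%N))))
    & (vanishes_uniformly_as PP (fun P k w =>
          (k%:R `^ q^-1)^-1 * \sum_(i < k) (X i w - centering P q (X 0%N)))
        <-> unif_integrable PP q (X 0%N))].
Proof.
have fwd := vanishes_of_unif_integrable hiid q_gt0 q_lt2 hint.
have bwd := unif_integrable_of_vanishes hiid q_gt0.
split.
- move=> q1 /fwd V.
  have cE P : real_expectation P (X 0%N) = centering P q (X 0%N).
    by rewrite /centering q1.
  rewrite (_ : (fun P k w => _) =
    (fun P => normalized_sum q (recenter X (centering P q (X 0%N)))))//.
  by apply/funext => P; apply/funext => k; apply/funext => w; rewrite cE.
- move=> q1 /fwd V.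
  rewrite (_ : (fun P k w => _) =
    (fun P => normalized_sum q (recenter X (centering P q (X 0%N)))))//.
  apply/funext => P; apply/funext => k; apply/funext => w.
  rewrite /normalized_sum; congr (_ * _); apply: eq_bigr => i _ /=.
  by rewrite /centering leNgt q1 /= subr0.
- by move=> nUI V; apply: nUI; exact: bwd.
- by split; [exact: bwd|exact: fwd].
Qed.
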